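(* Let $\{[x_1,y_1],[x_2,y_2],[x_3,y_3]\}$ be an aligned triple of intervals with $x_j\neq y_j$ for $j=1,2,3$, let $X=\{x_1,x_2,x_3\}$, $Y=\{y_1,y_2,y_3\}$, and let $\phi_{XY}$ be the unique Möbius map from $\mathrm{SL}_2(\mathbb{R})$ with $\phi_{XY}(x_j)=y_j$, $j=1,2,3$. (1) If $\phi_{XY}$ has at most one fixed point in $P\mathbb{R}^1$, then there is a unique (up to a parametrisation) continuous one-parameter subgroup $\psi(t)$, $t\in\mathbb{R}$, of Möbius maps from $\mathrm{SL}_2(\mathbb{R})$ which maps $[x_1,y_1]$ to $[x_2,y_2]$ and to $[x_3,y_3]$, that is, $$\psi(t_j)(x_1)=x_j,\qquad \psi(t_j)(y_1)=y_j\qquad\text{for some } t_j\in\mathbb{R},\quad j=2,3.$$ (2) Let $\phi_{XY}$ have two fixed points $x<y$ and let $C_{xy}$ be the orientation-inverting Möbius transformation defined in the context. For $j=1,2,3$ define $$x'_j=x_j,\quad y'_j=y_j,\quad x''_j=C_{xy}x_j,\quad y''_j=C_{xy}y_j\qquad\text{if } x<x_j<y,$$ $$x'_j=C_{xy}x_j,\quad y'_j=C_{xy}y_j,\quad x''_j=x_j,\quad y''_j=y_j\qquad\text{otherwise.}$$ Then there are a non-trivial continuous one-parameter subgroup $\psi(t)$ of Möbius maps from $\mathrm{SL}_2(\mathbb{R})$ and $t_2,t_3\in\mathbb{R}$ such that for $j=2,3$ $$\psi(t_j)(x'_1)=x'_j,\quad \psi(t_j)(x''_1)=x''_j,\quad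 \psi(t_j)(y'_1)=y'_j,\quad \psi(t_j)(y''_1)=y''_j.$$
   Context: A real invertible $2\times2$ matrix $\begin{pmatrix}a&b\\c&d\end{pmatrix}$ acts on the real projective line $P\mathbb{R}^1=\mathbb{R}\cup\{\infty\}$ by the Möbius map $x\mapsto\frac{ax+b}{cx+d}$; the point $\infty$ is regarded as greater than any real number. An interval $[x,y]$ here is an ordered pair of points of $P\mathbb{R}^1$. A triple $\{x_1,x_2,x_3\}$ of distinct points is positively oriented if, after a cyclic permutation of indices, $x_1<x_2<x_3$ (for real points: $(x_1-x_2)(x_2-x_3)(x_3-x_1)>0$); otherwise a triple of distinct points is negatively oriented. A triple of intervals $\{[x_1,y_1],[x_2,y_2],[x_3,y_3]\}$ is aligned if the triples of distinct points $X=\{x_1,x_2,x_3\}$ and $Y=\{y_1,y_2,y_3\}$ have the same orientation. For two triples of the same orientation there is a unique Möbius map $\phi_{XY}$, given by an element of $\mathrm{SL}_2(\mathbb{R})$, with $\phi_{XY}(x_j)=y_j$ for $j=1,2,3$. For real $x\neq y$, $C_{xy}$ is the Möbius transformation with the matrix $\begin{pmatrix}\frac{x+y}{2}&-xy\\1&-\frac{x+y}{2}\end{pmatrix}$; for $y=\infty$ it is given by $\begin{pmatrix}\frac12&-x\\0&-\frac12\end{pmatrix}$. A one-parameter subgroup is a continuous homomorphism $\psi:\mathbb{R}\to\mathrm{SL}_2(\mathbb{R})$; ''up to a parametrisation'' means up to replacing $\psi(t)$ by $\psi(ct)$, $c\neq0$. *)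

(* Defs.v *)
From HB Require Import structures.
From mathcomp Require Import all_boot all_order all_algebra.
From mathcomp Require Import all_classical all_reals all_analysis.
Import Order.TTheory GRing.Theory Num.Theory.
Import numFieldNormedType.Exports.

Set Implicit Arguments.
Unset Strict Implicit.
Unset Printing Implicit Defensive.

Local Open Scope ring_scope.

(* The real projective line, with [Some r] the real point r and [None] the
   point at infinity. *)
Definition projline (R : realType) : Type := option R.

(* Infinity is greater than every real number. *)
Definition pltb (R : realType) (p q : projline R) : bool :=
  match p, q with
  | Some r, Some s => r < s
  | Some _, None => true
  | None, _ => false
  end.

Definition mx2 (R : realType) (a b c d : R) : 'M[R]_2 :=
  \matrix_(i, j) if i == 0 then (if j == 0 then a else b)
                 else (if j == 0 then c else d).

(* The Moebius action; meaningful for invertible A only. *)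
Definition mobius (R : realType) (A : 'M[R]_2) (p : projline R) : projline R :=
  match p with
  | Some r => if A 1 0 * r + A 1 1 == 0 then None
              else Some ((A 0 0 * r + A 0 1) / (A 1 0 * r + A 1 1))
  | None => if A 1 0 == 0 then None else Some (A 0 0 / A 1 0)
  end.

(* Triples are indexed by 'I_3, whose addition is modulo 3, so that i, i + 1,
   i + 2 runs over the cyclic permutations of the indices.  A triple of distinct
   points is negatively oriented when this is false. *)
Definition pos_oriented (R : realType) (x : 'I_3 -> projline R) : bool :=
  [exists i : 'I_3, pltb (x i) (x (i + 1)) && pltb (x (i + 1)) (x (i + 2))].

Definition aligned (R : realType) (x y : 'I_3 -> projline R) : Prop :=
  [/\ injective x, injective y & pos_oriented x = pos_oriented y].

(* The matrix of C_xy.  The first point is taken real: whenever x < y in the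
   projective line, x is finite. *)
Definition Cmx (R : realType) (x : R) (y : projline R) : 'M[R]_2 :=
  match y with
  | Some y' => mx2 ((x + y') / 2) (- (x * y')) 1 (- ((x + y') / 2))
  | None => mx2 (1 / 2) (- x) 0 (- (1 / 2))
  end.

Definition one_param_subgroup (R : realType) (psi : R -> 'M[R]_2) : Prop :=
  [/\ continuous psi,
      forall t, \det (psi t) = 1
    & forall s t, psi (s + t) = psi s *m psi t].

(* The first interval, of index 0, is mapped to each of the other two. *)
Definition maps_first_interval (R : realType) (x y : 'I_3 -> projline R)
    (psi : R -> 'M[R]_2) : Prop :=
  forall j : 'I_3, j != 0 ->
    exists t : R, mobius (psi t) (x 0) = x j /\ mobius (psi t) (y 0) = y j.

(* Main.v *)
Require Import Defs.
From HB Require Import structures.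
From mathcomp Require Import all_boot all_order all_algebra.
From mathcomp Require Import all_classical all_reals all_analysis.
From mathcomp Require Import ring lra.
Import Order.TTheory GRing.Theory Num.Theory.
Import numFieldNormedType.Exports.
Local Open Scope ring_scope.

(** Put [N = phi - (tr phi / 2)], a traceless matrix, so that [N^2 = - det N].
    The elements [a + b N] of determinant 1 form the conic
    [a^2 + b^2 det N = 1], and [exp (t N) = c t + s t N] runs along it, with
    [(c, s)] circular, affine or hyperbolic according to the sign of [det N]
    ([conic_parametrisation], [one_param_of_traceless]).  Points of the
    projective line are represented by vectors, and the quadratic form
    [Q v = cross v (N v)] satisfies [Q (g v) = det g * Q v] for [g = a + b N].
    If [v] is not an eigenvector, every other vector is [g v] for some such
    [g]; therefore the flow of [N] is transitive on the points where [Q] has a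
    given sign ([traceless_flow]).

    Part (1), existence: having at most one fixed point forces [det N >= 0], so
    that all determinants in the pencil are nonnegative and the flow carries
    [x 0] to each [x j], none of them being fixed by [phi].  It commutes with
    [phi], hence also carries [y 0] to [y j].

    Part (1), uniqueness: let [psi'] carry the first interval to the others.
    Some combination [chi] of the identity and [psi' t1] sends [x 0] to [y 0].
    As it commutes with [psi'], it sends every [x j] to [y j], as [phi] does;
    three points determine a projective map, so [chi] is proportional to [phi]
    and [psi'] commutes with [phi] ([maps_first_interval_comm]).  Thus [psi']
    takes values in the pencil of [N].  At a small time [e] it has positive
    trace and so meets the flow [psi] of [N], say [psi' e = psi s]; then
    [psi' t = psi ((s / e) * t)], since square roots of positive trace are
    unique in SL2 and dyadic multiples of [e] are dense ([one_param_eq]).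

    Part (2): [C_ab] is traceless with the same fixed points as [phi], so both
    commute, and its form [Q] is negative exactly between [a] and [b].  Since
    [det C_ab < 0], the map [C_ab] exchanges the two signs of [Q], so all the
    points [x' j] lie between [a] and [b], where the flow of [C_ab] is
    transitive.  The points [y' j], [x'' j] and [y'' j] are the images of
    [x' j] under [phi], [C_ab] and their product, which commute with the flow. *)

(** * Linear algebra of the real plane *)

Section MoebiusFlows.
Variable R : realType.
Implicit Types (A B N D : 'M[R]_2) (u v w : 'cV[R]_2) (p q : projline R).

Lemma I2_cases (P : 'I_2 -> Prop) : P 0 -> P 1 -> forall i, P i.
Proof.
move=> P0 P1 [[|[|//]] lti].
- by rewrite (_ : Ordinal lti = 0) //; apply: val_inj.
- by rewrite (_ : Ordinal lti = 1) //; apply: val_inj.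
Qed.

Lemma mulmx2E n m (A : 'M[R]_(n, 2)) (B : 'M[R]_(2, m)) i j :
  (A *m B) i j = A i 0 * B 0 j + A i 1 * B 1 j.
Proof.
rewrite mxE !big_ord_recl big_ord0 addr0.
by rewrite (_ : lift ord0 ord0 = 1 :> 'I_2) //; apply: val_inj.
Qed.

Lemma det2E A : \det A = A 0 0 * A 1 1 - A 0 1 * A 1 0.
Proof.
rewrite (expand_det_row _ 0) !big_ord_recl big_ord0 addr0.
rewrite (_ : lift ord0 ord0 = 1 :> 'I_2); last exact: val_inj.
rewrite /cofactor !det_mx11 !mxE /= expr0 mul1r ?addn0 ?addn1 expr1 mulN1r mulrN.
by congr (_ * A _ _ - _ * A _ _); apply: val_inj.
Qed.

Lemma tr2E A : \tr A = A 0 0 + A 1 1.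
Proof.
rewrite /mxtrace !big_ord_recl big_ord0 addr0.
by rewrite (_ : lift ord0 ord0 = 1 :> 'I_2) //; apply: val_inj.
Qed.

Lemma mx2_eq A B : A 0 0 = B 0 0 -> A 0 1 = B 0 1 -> A 1 0 = B 1 0 ->
  A 1 1 = B 1 1 -> A = B.
Proof. by move=> e1 e2 e3 e4; apply/matrixP; do 2![apply: I2_cases]. Qed.

Lemma col2_eq u v : u 0 0 = v 0 0 -> u 1 0 = v 1 0 -> u = v.
Proof.
by move=> e0 e1; apply/matrixP; apply: I2_cases => j; rewrite ord1.
Qed.

Lemma scalar2E (a : R) :
  ((a%:M : 'M[R]_2) 0 0 = a) * ((a%:M : 'M[R]_2) 0 1 = 0) *
  ((a%:M : 'M[R]_2) 1 0 = 0) * ((a%:M : 'M[R]_2) 1 1 = a).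
Proof. by rewrite !mxE /= !mulr1n !mulr0n. Qed.

(** Cayley-Hamilton for a traceless matrix. *)
Lemma traceless_sqr N : \tr N = 0 -> N *m N = (- \det N)%:M.
Proof.
rewrite tr2E det2E => trN; have N11 : N 1 1 = - N 0 0 by lra.
by apply: mx2_eq; rewrite mulmx2E scalar2E N11; ring.
Qed.

Lemma pencilE N (a b : R) (i j : 'I_2) :
  (a%:M + b *: N) i j = a *+ (i == j) + b * N i j.
Proof. by rewrite !mxE. Qed.

Lemma det_pencil N (a b : R) : \tr N = 0 ->
  \det (a%:M + b *: N) = a ^+ 2 + b ^+ 2 * \det N.
Proof.
rewrite tr2E !det2E => trN; have N11 : N 1 1 = - N 0 0 by lra.
by rewrite !pencilE N11 /= !mulr1n !mulr0n; ring.
Qed.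

Lemma comm_pencilr A B (a b : R) : comm_mx A B -> comm_mx A (a%:M + b *: B).
Proof.
by move=> AB; rewrite /comm_mx mulmxDr mulmxDl scalar_mxC -scalemxAr AB -scalemxAl.
Qed.

Lemma pencil_comm A (a b : R) : comm_mx A (a%:M + b *: A).
Proof. exact/comm_pencilr/comm_mx_refl. Qed.

(** The signed area of the parallelogram on two vectors of the plane; it
    vanishes exactly when they are collinear. *)
Definition cross u v : R := u 0 0 * v 1 0 - u 1 0 * v 0 0.

Lemma crossC u v : cross u v = - cross v u.
Proof. by rewrite /cross; ring. Qed.

Lemma crossZl (k : R) u v : cross (k *: u) v = k * cross u v.
Proof. by rewrite /cross !mxE; ring. Qed.

Lemma crossZr (k : R) u v : cross u (k *: v) = k * cross u v.
Proof. by rewrite /cross !mxE; ring. Qed.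

Lemma crossDr u v w : cross u (v + w) = cross u v + cross u w.
Proof. by rewrite /cross !mxE; ring. Qed.

Lemma crossv u : cross u u = 0.
Proof. by rewrite /cross; ring. Qed.

Lemma cross_mulmx A u v : cross (A *m u) (A *m v) = \det A * cross u v.
Proof. by rewrite /cross !mulmx2E det2E; ring. Qed.

Lemma cross_basis u v w : cross u v != 0 ->
  w = (cross w v / cross u v) *: u + (cross u w / cross u v) *: v.
Proof.
by move=> uv; apply: col2_eq; rewrite !mxE; move: uv; rewrite /cross => uv; field.
Qed.

Lemma cross_collinear u v : u != 0 -> cross u v = 0 -> exists k : R, v = k *: u.
Proof.
move=> u0 uv; have [u00|u00] := eqVneq (u 0 0) 0.
  have u10 : u 1 0 != 0.
    by apply: contra u0 => /eqP u10; apply/eqP; apply: col2_eq; rewrite mxE.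
  exists (v 1 0 / u 1 0); apply: col2_eq; rewrite !mxE; last by field.
  move: uv; rewrite /cross u00 mul0r sub0r => /eqP.
  by rewrite oppr_eq0 mulf_eq0 (negPf u10) /= mulr0 => /eqP.
exists (v 0 0 / u 0 0); apply: col2_eq; rewrite !mxE; first by field.
apply: (mulfI u00); move: uv; rewrite /cross => uv.
rewrite mulrCA mulrA mulfVK // mulrC. lra.
Qed.

(** A linear map is determined by its values on a basis. *)
Lemma mx2_basis_eq A B u v : cross u v != 0 ->
  A *m u = B *m u -> A *m v = B *m v -> A = B.
Proof.
move=> uv Au Av; have Aw w : A *m w = B *m w.
  by rewrite (cross_basis u v w uv) !mulmxDr -!scalemxAr Au Av.
apply/matrixP => i j; have := Aw (delta_mx j 0).
by rewrite -!colE => /matrixP/(_ i 0); rewrite !mxE.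
Qed.

Lemma eigenbasis_comm A B u v (a b c d : R) : cross u v != 0 ->
  A *m u = a *: u -> A *m v = b *: v -> B *m u = c *: u -> B *m v = d *: v ->
  comm_mx A B.
Proof.
move=> uv Au Av Bu Bv; apply: (mx2_basis_eq _ _ _ _ uv).
- by rewrite -!mulmxA Bu Au -!scalemxAr Au Bu !scalerA mulrC.
- by rewrite -!mulmxA Bv Av -!scalemxAr Av Bv !scalerA mulrC.
Qed.

(** The centraliser of a map with a cyclic vector consists of its polynomials,
    so of affine combinations with the identity in dimension two. *)
Lemma comm_pencil A B u : cross u (A *m u) != 0 -> comm_mx A B ->
  exists a b : R, B = a%:M + b *: A.
Proof.
move=> uA AB; have Bu := cross_basis _ _ (B *m u) uA.
set a := (X in X *: u) in Bu; set b := (X in X *: (A *m u)) in Bu.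
have Cu : (a%:M + b *: A) *m u = B *m u.
  by rewrite mulmxDl mul_scalar_mx -scalemxAl -Bu.
exists a, b; apply: (mx2_basis_eq _ _ _ _ uA) => //.
by rewrite !mulmxA -AB -pencil_comm -!mulmxA Cu.
Qed.

(** Three pairwise independent eigenvectors force a map to be scalar. *)
Lemma three_eigen_scalar D u v w :
  cross u v != 0 -> cross v w != 0 -> cross u w != 0 ->
  cross u (D *m u) = 0 -> cross v (D *m v) = 0 -> cross w (D *m w) = 0 ->
  exists k : R, D = k%:M.
Proof.
move=> uv vw uw Du Dv Dw.
have u0 : u != 0 by apply: contra uv => /eqP ->; rewrite /cross !mxE !mul0r subrr.
have v0 : v != 0 by apply: contra vw => /eqP ->; rewrite /cross !mxE !mul0r subrr.
have [a Ea] := cross_collinear _ _ u0 Du.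
have [b Eb] := cross_collinear _ _ v0 Dv.
suff ab : a = b.
  by exists a; apply: (mx2_basis_eq _ _ _ _ uv); rewrite mul_scalar_mx ?Ea // Eb ab.
have Ew := cross_basis _ _ w uv.
move: Dw; rewrite {2}Ew mulmxDr -!scalemxAr Ea Eb crossDr !crossZr.
have -> : cross w u = - cross u w by rewrite crossC.
have -> : cross w v = - cross v w by rewrite crossC.
move=> H; have : (a - b) * (cross v w * cross u w / cross u v) = 0.
  by rewrite -H; field.
move=> /eqP; rewrite mulf_eq0 subr_eq0 => /orP[/eqP //|].
by rewrite !mulf_eq0 invr_eq0 (negPf uv) (negPf vw) (negPf uw).
Qed.

(** * Points of the projective line as vectors *)

(** The standard vector spanning the line that a projective point stands for:
    [(r, 1)] for a real [r], and [(1, 0)] for infinity. *)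
Definition rep p : 'cV[R]_2 :=
  if p is Some r then \col_i (if i == 0 then r else 1)
  else \col_i (if i == 0 then 1 else 0).

Lemma repS (r : R) : (rep (Some r) 0 0 = r) * (rep (Some r) 1 0 = 1).
Proof. by rewrite !mxE. Qed.

Lemma repN : (rep None 0 0 = 1) * (rep None 1 0 = 0).
Proof. by rewrite !mxE. Qed.

Lemma rep_neq0 p : rep p != 0.
Proof.
apply/eqP => /matrixP E; case: p E => [r|] E.
  by have := E 1 0; rewrite repS mxE; lra.
by have := E 0 0; rewrite repN mxE; lra.
Qed.

Lemma cross_rep_eq0 p q : (cross (rep p) (rep q) == 0) = (p == q).
Proof.
apply/idP/idP => [|/eqP ->]; last by rewrite crossv.
move: p q => [r|] [s|] //; rewrite /cross ?repS ?repN => /eqP E; last first.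
- by exfalso; lra.
- by exfalso; lra.
by apply/eqP; congr Some; lra.
Qed.

Lemma mobius_rep A p : \det A != 0 ->
  exists2 k : R, k != 0 & A *m rep p = k *: rep (mobius A p).
Proof.
rewrite det2E => dA; case: p => [r|] /=; case: eqP => [E|/eqP E].
- exists (A 0 0 * r + A 0 1).
    apply: contra dA => /eqP E0; apply/eqP.
    have A01 : A 0 1 = - (A 0 0 * r) by lra.
    have A11 : A 1 1 = - (A 1 0 * r) by lra.
    by rewrite A01 A11; ring.
  by apply: col2_eq; rewrite mulmx2E [in RHS]mxE ?repS ?repN; lra.
- exists (A 1 0 * r + A 1 1) => //.
  by apply: col2_eq; rewrite mulmx2E [in RHS]mxE ?repS ?repN; field.
- exists (A 0 0); first by apply: contra dA => /eqP ->; rewrite E mul0r mulr0 subr0.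
  by apply: col2_eq; rewrite mulmx2E [in RHS]mxE ?repS ?repN ?E; ring.
- exists (A 1 0) => //.
  by apply: col2_eq; rewrite mulmx2E [in RHS]mxE ?repS ?repN; field.
Qed.

Lemma mobiusP A p q : \det A != 0 ->
  mobius A p = q <-> cross (A *m rep p) (rep q) = 0.
Proof.
move=> dA; have [k k0 ->] := mobius_rep _ p dA; rewrite crossZl; split=> [->|/eqP].
  by rewrite crossv mulr0.
by rewrite mulf_eq0 (negPf k0) cross_rep_eq0 => /eqP.
Qed.

Lemma mobius_fixP A p : \det A != 0 ->
  mobius A p = p <-> cross (rep p) (A *m rep p) = 0.
Proof.
move=> dA; rewrite mobiusP // crossC; split=> /eqP.
  by rewrite oppr_eq0 => /eqP.
by move=> /eqP ->; rewrite oppr0.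
Qed.

Lemma mobiusM A B p : \det A != 0 -> \det B != 0 ->
  mobius (A *m B) p = mobius A (mobius B p).
Proof.
move=> dA dB; apply/mobiusP; first by rewrite det_mulmx mulf_neq0.
have [k k0 E] := mobius_rep _ p dB.
have [l l0 F] := mobius_rep _ (mobius B p) dA.
by rewrite -mulmxA E -scalemxAr F !crossZl crossv !mulr0.
Qed.

Lemma mobius_scalar (k : R) p : k != 0 -> mobius k%:M p = p.
Proof.
move=> k0; apply/mobiusP; first by rewrite det_scalar expf_neq0.
by rewrite mul_scalar_mx crossZl crossv mulr0.
Qed.

Lemma mobius_comm A B p : \det A != 0 -> \det B != 0 -> comm_mx A B ->
  mobius A (mobius B p) = mobius B (mobius A p).
Proof. by move=> dA dB AB; rewrite -!mobiusM // AB. Qed.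

(** The point of the pencil of [N] that carries [p] to [q]: the determinant
    compares the values at [p] and [q] of the quadratic form [cross v (N v)]. *)
Lemma pencil_transport N p q : cross (rep p) (N *m rep p) != 0 ->
  exists a b : R, rep q = (a%:M + b *: N) *m rep p /\
    \det (a%:M + b *: N) * cross (rep p) (N *m rep p) =
      cross (rep q) (N *m rep q).
Proof.
move=> Np; have E := cross_basis _ _ (rep q) Np.
set a := (X in X *: rep p) in E; set b := (X in X *: (N *m _)) in E.
have F : rep q = (a%:M + b *: N) *m rep p.
  by rewrite mulmxDl mul_scalar_mx -scalemxAl -E.
exists a, b; split=> //.
by rewrite F mulmxA pencil_comm -mulmxA cross_mulmx.
Qed.

(** * One-parameter subgroups of SL2 *)

(** Square roots of positive trace are unique in SL2, by Cayley-Hamilton. *)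
Lemma SL2_sqrt_unique A B : \det A = 1 -> \det B = 1 -> 0 < \tr A -> 0 < \tr B ->
  A *m A = B *m B -> A = B.
Proof.
(* Cayley-Hamilton, with determinant 1. *)
have CH (C : 'M[R]_2) : \det C = 1 -> C *m C = \tr C *: C - 1%:M.
  rewrite det2E tr2E => dC.
  by apply: mx2_eq; rewrite mulmx2E !mxE /= ?mulr1n ?mulr0n; lra.
move=> dA dB tA tB AB.
have trsq (C : 'M[R]_2) : \det C = 1 -> \tr (C *m C) = \tr C ^+ 2 - 2.
  by move=> dC; rewrite CH // raddfB /= linearZ /= mxtrace_scalar.
have /eqP : \tr A ^+ 2 = \tr B ^+ 2.
  by apply: (addIr (-2)); rewrite -!trsq // AB.
rewrite eqrXn2 ?ltW // => /eqP tAB.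
move: AB; rewrite !CH // tAB => /addIr/scalerI; apply.
by rewrite gt_eqF.
Qed.

Local Open Scope classical_set_scope.
Local Open Scope ring_scope.

(** A continuous function with arbitrarily small periods is constant. *)
Lemma dyadic_periods_const (f : R -> R) (e : R) : 0 < e -> continuous f ->
  (forall (n : nat) (t : R), f (t + e / 2 ^+ n) = f t) -> forall t, f t = f 0.
Proof.
move=> e0 cf per t; apply: contrapT => ft.
have d0 : 0 < `|f 0 - f t| by rewrite normr_gt0 subr_eq0 eq_sym; apply/eqP.
have /cvgrPdist_lt/(_ _ d0)/nbhs_normP[h /= h0 hf] := cf 0.
have [n hn] : exists n, e / 2 ^+ n < h.
  (* [n < 2^n] turns the Archimedean bound into a power of 2. *)
  exists (Num.bound (e / h)); have eh : 0 <= e / h by rewrite divr_ge0 // ltW.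
  rewrite ltr_pdivrMr ?exprn_gt0 // -ltr_pdivrMl // mulrC.
  by rewrite (lt_trans (archi_boundP eh)) // -natrX ltr_nat ltn_expl.
set u := e / 2 ^+ n in hn; have u0 : 0 < u by rewrite divr_gt0 // exprn_gt0.
have peru (m : nat) s : f (s + u *+ m) = f s.
  by elim: m => [|m IH]; rewrite ?addr0 // mulrSr addrA per IH.
have perz (m : int) s : f (s + u *~ m) = f s.
  by case: m => m; rewrite ?NegzE -?pmulrn ?mulrNz -?pmulrn ?peru //
    -[LHS](peru m.+1) subrK.
have [] := andP (floor_itv (t / u)); set m := Num.floor _.
rewrite ler_pdivlMr // ltr_pdivrMr // intrD mulrDl mul1r => m1 m2.
have E := perz (- m) t; rewrite mulrNz -mulrzl in E.
have : `|f 0 - f (t - m%:~R * u)| < `|f 0 - f t|.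
  by apply: hf; rewrite /ball_ /= sub0r normrN ger0_norm; lra.
by rewrite E ltxx.
Qed.

Lemma continuous_scale_arg (f : R -> R) (w : R) :
  continuous f -> continuous (fun t => f (w * t)).
Proof.
by move=> cf t; apply: continuous_comp; [exact: mulrl_continuous|exact: cf].
Qed.

Lemma continuous_scale_val (f : R -> R) (w : R) :
  continuous f -> continuous (fun t => f t / w).
Proof.
move=> cf t; apply: (@continuousM _ _ f (cst w^-1)); first exact: cf.
exact: cst_continuous.
Qed.

(** A continuous pair obeying the addition laws that runs along the conic
    [a^2 - d b^2 = 1] and covers its part [0 <= a]: circular functions for
    [d < 0], [(1, t)] for [d = 0] and hyperbolic functions for [d > 0].  The
    parameter of a point with [0 < a] can be chosen so that the first
    coordinate stays positive on the whole segment from 0 to it. *)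
Lemma conic_parametrisation (d : R) : exists c s : R -> R,
  [/\ continuous c /\ continuous s,
      forall t t', c (t + t') = c t * c t' + d * (s t * s t') /\
                   s (t + t') = s t * c t' + c t * s t',
      forall t, c t ^+ 2 - d * s t ^+ 2 = 1
    & forall a b, 0 <= a -> a ^+ 2 - d * b ^+ 2 = 1 -> exists t,
        [/\ c t = a, s t = b &
            0 < a -> forall r, 0 <= r <= 1 -> 0 < c (r * t)]].
Proof.
have [d0|d0|->] := ltgtP d 0.
- set w := Num.sqrt (- d).
  have w0 : 0 < w by rewrite sqrtr_gt0; lra.
  have dw : d = - w ^+ 2 by rewrite sqr_sqrtr; lra.
  exists (fun t => cos (w * t)), (fun t => sin (w * t) / w); split.
  + split; first by apply: continuous_scale_arg; exact: continuous_cos.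
    by apply: continuous_scale_val; apply: continuous_scale_arg; exact: continuous_sin.
  + by move=> t t'; rewrite mulrDr cosD sinD dw; split; field; rewrite gt_eqF.
  + move=> t; rewrite dw -[RHS](cos2Dsin2 (w * t)); field; by rewrite gt_eqF.
  + (* The parameter is [asin (b w) / w], at which the cosine is
       [sqrt (1 - (b w)^2) = a]. *)
    move=> a b a0; rewrite dw => ab; have bw : (b * w) ^+ 2 = 1 - a ^+ 2 by lra.
    have a1 : 0 <= a ^+ 2 by exact: sqr_ge0.
    have bw1 : -1 <= b * w <= 1 by apply/andP; split; nra.
    exists (asin (b * w) / w); rewrite mulrC divfK ?gt_eqF //; split.
    * by rewrite cos_asin // bw opprB addrC subrK sqrtr_sqr ger0_norm.
    * by rewrite asinK ?in_itv // mulfK // gt_eqF.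
    * move=> ap r /andP[r0 r1].
      have bw2 : -1 < b * w < 1.
        have : 0 < a ^+ 2 by rewrite exprn_gt0.
        by move=> ?; apply/andP; split; nra.
      rewrite mulrCA (mulrC w) divfK ?gt_eqF //.
      have := @asin_ltpi2 R (b * w); have := @asin_gtNpi2 R (b * w).
      move: bw2 => /andP[B1 B2]; rewrite B1 B2 !ltW // => /(_ isT) A1 /(_ isT) A2.
      have p0 : 0 < pi / 2 :> R by rewrite divr_gt0 ?pi_gt0.
      apply: cos_gt0_pihalf; apply/andP; split; nra.
- set w := Num.sqrt d.
  have w0 : 0 < w by rewrite sqrtr_gt0.
  have dw : d = w ^+ 2 by rewrite sqr_sqrtr // ltW.
  have ec : continuous (fun t => expR (w * t)).
    by apply: continuous_scale_arg; exact: continuous_expR.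
  have ecN : continuous (fun t => expR (- w * t)).
    by apply: continuous_scale_arg; exact: continuous_expR.
  have EN t : expR (- w * t) = (expR (w * t))^-1 by rewrite mulNr expRN.
  have E0 t : expR (w * t) != 0 by rewrite gt_eqF // expR_gt0.
  have wn : w != 0 by rewrite gt_eqF.
  exists (fun t => (expR (w * t) + expR (- w * t)) / 2),
         (fun t => (expR (w * t) - expR (- w * t)) / 2 / w); split.
  + split.
      by apply: continuous_scale_val => t; exact: (continuousD (ec t) (ecN t)).
    do 2!apply: continuous_scale_val.
    by move=> t; exact: (continuousB (ec t) (ecN t)).
  + by move=> t t'; rewrite !EN mulrDr expRD dw; split; field; rewrite wn !E0.
  + by move=> t; rewrite !EN dw; field; rewrite wn E0.
  + (* The exponential of the parameter is [a + b w], with inverse [a - b w]. *)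
    move=> a b a0; rewrite dw => ab.
    have ab1 : (a + b * w) * (a - b * w) = 1 by lra.
    have abp : 0 < a + b * w.
      by rewrite ltNge; apply/negP => H; nra.
    have abi : (a + b * w)^-1 = a - b * w.
      by apply: (mulfI (lt0r_neq0 abp)); rewrite mulfV ?lt0r_neq0.
    exists (ln (a + b * w) / w); rewrite EN (mulrC w) divfK // lnK // abi; split.
    * by field.
    * by field.
    * by move=> _ r _; rewrite divr_gt0 // addr_gt0 ?expR_gt0.
- exists (fun=> 1), id; split.
  + by split => t; [exact: cst_continuous|].
  + by move=> t t'; split; ring.
  + by move=> t; ring.
  + move=> a b a0; rewrite mul0r subr0 => /eqP; rewrite sqrf_eq1 => /orP[] /eqP aE.
      by exists b; split; rewrite ?aE.
    by exfalso; lra.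
Qed.

Lemma one_param0 (psi : R -> 'M[R]_2) : one_param_subgroup psi -> psi 0 = 1%:M.
Proof.
move=> [_ d1 M]; have u : psi 0 \in unitmx by rewrite unitmxE d1 unitr1.
by rewrite -[LHS](mulKmx u) -M addr0 mulVmx.
Qed.

Lemma one_param_scale (psi : R -> 'M[R]_2) (k : R) :
  one_param_subgroup psi -> one_param_subgroup (fun t => psi (k * t)).
Proof.
move=> [c d1 M]; split=> // [t|s t]; last by rewrite mulrDr M.
by apply: continuous_comp; [exact: mulrl_continuous|exact: c].
Qed.

Lemma one_param_entry (psi : R -> 'M[R]_2) i j :
  one_param_subgroup psi -> continuous (fun t => psi t i j).
Proof.
move=> [c _ _] t.
by apply: (@continuous_comp _ _ _ psi (fun M : 'M[R]_2 => M i j));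
  [exact: c|exact: coord_continuous].
Qed.

(** Two one-parameter subgroups that agree at [e] and have positive traces on
    [[0, e]] agree at every [e / 2^n] by uniqueness of square roots; hence
    [psi1 t * psi2 (- t)] has arbitrarily small periods and is constant. *)
Lemma one_param_eq (psi1 psi2 : R -> 'M[R]_2) (e : R) :
  one_param_subgroup psi1 -> one_param_subgroup psi2 -> 0 < e ->
  (forall t, 0 <= t <= e -> 0 < \tr (psi1 t)) ->
  (forall t, 0 <= t <= e -> 0 < \tr (psi2 t)) ->
  psi1 e = psi2 e -> forall t, psi1 t = psi2 t.
Proof.
move=> H1 H2 e0 tr1 tr2 E; have [c1 d1 M1] := H1; have [c2 d2 M2] := H2.
have dy n : psi1 (e / 2 ^+ n) = psi2 (e / 2 ^+ n).
  elim: n => [|n IH]; first by rewrite expr0 divr1.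
  have u0 : 0 <= e / 2 ^+ n.+1 <= e.
    apply/andP; split; first by rewrite divr_ge0 ?exprn_ge0 // ltW.
    by rewrite ler_pdivrMr ?exprn_gt0 // ler_peMr ?exprn_ege1 ?ler1n // ltW.
  apply: SL2_sqrt_unique; rewrite ?d1 ?d2 ?tr1 ?tr2 // -M1 -M2.
  suff -> : e / 2 ^+ n.+1 + e / 2 ^+ n.+1 = e / 2 ^+ n by [].
  by rewrite exprS; field; rewrite expf_neq0.
pose h t := psi1 t *m psi2 (- t).
have inv2 t : psi2 t *m psi2 (- t) = 1%:M by rewrite -M2 subrr one_param0.
have hper n t : h (t + e / 2 ^+ n) = h t.
  by rewrite /h opprD (addrC (- t)) M1 M2 dy mulmxA -(mulmxA (psi1 t)) inv2 mulmx1.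
have h1 t : h t = 1%:M.
  have <- : h 0 = 1%:M by rewrite /h oppr0 !one_param0 // mulmx1.
  apply/matrixP => i j; apply: (dyadic_periods_const (fun t => h t i j) e e0).
    have c2N k l : continuous (fun t => psi2 (- t) k l).
      move=> s; apply: (@continuous_comp _ _ _ -%R (fun t => psi2 t k l)).
        exact: opp_continuous.
      exact: one_param_entry.
    rewrite (_ : (fun t => h t i j) = (fun t => psi1 t i 0 * psi2 (- t) 0 j +
        psi1 t i 1 * psi2 (- t) 1 j)); last by apply: funext => s; rewrite mulmx2E.
    have c1E k l := one_param_entry psi1 k l H1.
    by move=> s; exact: (continuousD (continuousM (c1E i 0 s) (c2N 0 j s))
                                     (continuousM (c1E i 1 s) (c2N 1 j s))).
  by move=> n s /=; rewrite hper.
move=> t; have := congr1 (fun M => M *m psi2 t) (h1 t).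
by rewrite /h -mulmxA -M2 addNr one_param0 // mulmx1 mul1mx.
Qed.

Lemma one_param_trace_gt0 (psi : R -> 'M[R]_2) : one_param_subgroup psi ->
  exists2 e : R, 0 < e & forall t, 0 <= t <= e -> 0 < \tr (psi t).
Proof.
move=> H.
have ct : (fun t => psi t 0 0 + psi t 1 1) x @[x --> (0 : R)] -->
    (psi 0 0 0 + psi 0 1 1).
  exact: (cvgD (one_param_entry psi 0 0 H 0) (one_param_entry psi 1 1 H 0)).
have p0 : 0 < psi 0 0 0 + psi 0 1 1.
  by rewrite one_param0 // !mxE /= mulr1n; lra.
have /nbhs_normP[h /= h0 hf] :
  \forall t \near (0 : R), 0 < psi t 0 0 + psi t 1 1 by exact: (cvgr_gt _ ct).
exists (h / 2) => [|t /andP[t0 th]]; first by rewrite divr_gt0.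
by rewrite tr2E; apply: hf; rewrite /ball_ /= sub0r normrN ger0_norm //; lra.
Qed.

(** The exponential of a traceless [N], written in the pencil that [N] spans
    with the identity; it passes through every [a + b N] of determinant 1 with
    [0 <= a]. *)
Lemma one_param_of_traceless N : \tr N = 0 ->
  exists psi : R -> 'M[R]_2,
  [/\ one_param_subgroup psi,
      forall t, exists a b : R, psi t = a%:M + b *: N
    & forall a b : R, 0 <= a -> \det (a%:M + b *: N) = 1 -> exists t,
        psi t = a%:M + b *: N /\
        (0 < a -> forall r, 0 <= r <= 1 -> 0 < \tr (psi (r * t)))].
Proof.
move=> trN; have [c [s [[cc cs] add norm param]]] := conic_parametrisation (- \det N).
exists (fun t => (c t)%:M + s t *: N); split.
- split.
  + rewrite (_ : (fun t => _) = (fun t => c t *: 1%:M + s t *: N)).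
      by move=> t; exact: (cvgD (cvgZr_tmp (cc t)) (cvgZr_tmp (cs t))).
    by apply: funext => t; rewrite scale_scalar_mx mulr1.
  + by move=> t; rewrite det_pencil // -(norm t); ring.
  + move=> t t'; have [-> ->] := add t t'.
    move: trN; rewrite tr2E det2E => trN; have N11 : N 1 1 = - N 0 0 by lra.
    by apply: mx2_eq; rewrite mulmx2E !pencilE N11 /= !mulr1n !mulr0n; ring.
- by move=> t; exists (c t), (s t).
- move=> a b a0; rewrite det_pencil // => ab.
  have [|t [ca sb pos]] := param a b a0; first by lra.
  exists t; split; first by rewrite ca sb.
  move=> a1 r r1; rewrite raddfD /= linearZ /= trN mulr0 addr0 mxtrace_scalar.
  by rewrite pmulrn_lgt0 // pos.
Qed.

(** * Flows of traceless matrices on the projective line *)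

(** The flow of a traceless [N] is transitive on the points where the
    quadratic form [cross v (N v)] has a given nonzero sign. *)
Lemma traceless_flow N : \tr N = 0 ->
  exists psi : R -> 'M[R]_2,
  [/\ one_param_subgroup psi,
      forall t, exists a b : R, psi t = a%:M + b *: N,
      forall a b : R, 0 <= a -> \det (a%:M + b *: N) = 1 -> exists t,
        psi t = a%:M + b *: N /\
        (0 < a -> forall r, 0 <= r <= 1 -> 0 < \tr (psi (r * t)))
    & forall p q, 0 < cross (rep p) (N *m rep p) * cross (rep q) (N *m rep q) ->
        exists t, mobius (psi t) p = q].
Proof.
move=> trN; have [psi [H pen par]] := one_param_of_traceless N trN.
exists psi; split=> // p q pq; have [_ d1 _] := H.
have p0 : cross (rep p) (N *m rep p) != 0.
  by apply/eqP => E; move: pq; rewrite E mul0r ltxx.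
have [a [b [E F]]] := pencil_transport N p q p0.
have D0 : 0 < \det (a%:M + b *: N).
  move: pq; rewrite -F mulrCA -expr2 pmulr_lgt0 // lt_def sqrf_eq0 p0 /=.
  exact: sqr_ge0.
(* Rescale to determinant 1, with the sign that makes the scalar part
   nonnegative: [- g] acts on points as [g] does. *)
have [k [k0 k2 ka]] : exists k : R, [/\ k != 0,
    k ^+ 2 * \det (a%:M + b *: N) = 1 & 0 <= k * a].
  set r := (Num.sqrt (\det (a%:M + b *: N)))^-1.
  have r0 : 0 < r by rewrite invr_gt0 sqrtr_gt0.
  have r2 : r ^+ 2 * \det (a%:M + b *: N) = 1.
    by rewrite exprVn sqr_sqrtr ?mulVf ?gt_eqF // ltW.
  have [a0|a0] := leP 0 a.
    by exists r; split; rewrite ?gt_eqF // mulr_ge0 // ltW.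
  by exists (- r); split; rewrite ?oppr_eq0 ?gt_eqF ?sqrrN //; nra.
have [|t [Et _]] := par (k * a) (k * b) ka.
  by rewrite -k2 !det_pencil //; ring.
exists t; apply/mobiusP; first by rewrite d1 oner_eq0.
have -> : psi t = k *: (a%:M + b *: N).
  by rewrite Et scalerDr scale_scalar_mx scalerA.
by rewrite -scalemxAl -E crossZl crossv mulr0.
Qed.

(** The fixed points are the roots of a quadratic of positive discriminant
    [(tr A)^2 - 4], one of them being infinity when [A] is upper triangular. *)
Lemma hyperbolic_two_fixed A : \det A = 1 -> 4 < \tr A ^+ 2 ->
  exists p q, [/\ p <> q, mobius A p = p & mobius A q = q].
Proof.
move=> dA tA; have dA0 : \det A != 0 by rewrite dA oner_eq0.
have fixS x : A 1 0 * x ^+ 2 + (A 1 1 - A 0 0) * x - A 0 1 = 0 ->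
    mobius A (Some x) = Some x.
  by move=> Ex; apply/mobius_fixP => //; rewrite /cross !mulmx2E !repS -[RHS]Ex; ring.
move: dA tA; rewrite det2E tr2E => dA tA.
have [c0|c0] := eqVneq (A 1 0) 0.
  have ad : A 1 1 - A 0 0 != 0.
    by rewrite subr_eq0; apply/eqP => E; move: tA dA; rewrite c0 E; nra.
  exists None, (Some (A 0 1 / (A 1 1 - A 0 0))); split=> //.
    by rewrite /= c0 eqxx.
  by apply: fixS; rewrite c0; field.
set r := Num.sqrt ((A 0 0 + A 1 1) ^+ 2 - 4).
have r0 : 0 < r by rewrite sqrtr_gt0; lra.
have r2 : r ^+ 2 = (A 0 0 - A 1 1) ^+ 2 + 4 * A 1 0 * A 0 1.
  by rewrite sqr_sqrtr; [rewrite -[4]mulr1 -{1}dA; ring|lra].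
exists (Some ((A 0 0 - A 1 1 + r) / (2 * A 1 0))),
       (Some ((A 0 0 - A 1 1 - r) / (2 * A 1 0))); split.
- case=> /(congr1 (fun z => z * A 1 0)).
  rewrite (_ : _ / _ * _ = (A 0 0 - A 1 1 + r) / 2); last by field.
  rewrite (_ : _ / _ * _ = (A 0 0 - A 1 1 - r) / 2); last by field.
  lra.
- apply: fixS; transitivity
    ((r ^+ 2 - ((A 0 0 - A 1 1) ^+ 2 + 4 * A 1 0 * A 0 1)) / (4 * A 1 0)).
    by field.
  by rewrite r2 subrr mul0r.
- apply: fixS; transitivity
    ((r ^+ 2 - ((A 0 0 - A 1 1) ^+ 2 + 4 * A 1 0 * A 0 1)) / (4 * A 1 0)).
    by field.
  by rewrite r2 subrr mul0r.
Qed.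

(** Any one-parameter subgroup carrying the first interval to the other two
    commutes with the map taking left ends to right ends: the polynomial in
    [psi t1] that sends [x 0] to [y 0] commutes with the whole subgroup, hence
    sends each [x j] to [y j] and is proportional to [phi]. *)
Lemma maps_first_interval_comm (x y : 'I_3 -> projline R) (phi : 'M[R]_2)
    (psi : R -> 'M[R]_2) :
  injective x -> \det phi = 1 -> (forall j, mobius phi (x j) = y j) ->
  one_param_subgroup psi -> maps_first_interval x y psi ->
  forall t, comm_mx phi (psi t).
Proof.
move=> xinj dphi hphi H mf; have [_ d1 M] := H.
have crx i j : i != j -> cross (rep (x i)) (rep (x j)) != 0.
  by move=> ij; rewrite cross_rep_eq0 (inj_eq xinj).
have psiC s t : comm_mx (psi s) (psi t) by rewrite /comm_mx -!M addrC.
have [t1 [Ex1 _]] := mf 1 isT.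
have dA : \det (psi t1) != 0 by rewrite d1 oner_eq0.
have cyc : cross (rep (x 0)) (psi t1 *m rep (x 0)) != 0.
  by apply/eqP => /mobius_fixP; rewrite Ex1 => /(_ dA)/xinj.
have [a [b [Ey _]]] := pencil_transport (psi t1) (x 0) (y 0) cyc.
set chi := a%:M + b *: psi t1 in Ey.
have chiC t : comm_mx (psi t) chi by apply: comm_pencilr.
(* [chi] commutes with an element carrying [(x 0, y 0)] to [(x j, y j)]. *)
have chij j : cross (chi *m rep (x j)) (rep (y j)) = 0.
  have [t [Xt Yt]] : exists t, mobius (psi t) (x 0) = x j /\ mobius (psi t) (y 0) = y j.
    have [->|/mf //] := eqVneq j 0.
    by exists 0; rewrite one_param0 // !mobius_scalar ?oner_eq0.
  have dt : \det (psi t) != 0 by rewrite d1 oner_eq0.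
  have [k k0 Ek] := mobius_rep _ (x 0) dt; have [l l0 El] := mobius_rep _ (y 0) dt.
  rewrite Xt in Ek; rewrite Yt in El.
  have : cross (chi *m (k *: rep (x j))) (rep (y j)) = 0.
    by rewrite -Ek mulmxA -chiC -mulmxA -Ey El crossZl crossv mulr0.
  by rewrite -scalemxAr crossZl => /eqP; rewrite mulf_eq0 (negPf k0) => /eqP.
have dphi0 : \det phi != 0 by rewrite dphi oner_eq0.
have phiU : phi \in unitmx by rewrite unitmxE unitfE.
(* [phi^-1 chi] fixes the three points [x j], so it is scalar. *)
have Dj j : cross (rep (x j)) ((invmx phi *m chi) *m rep (x j)) = 0.
  have [k k0 Ek] := mobius_rep _ (x j) dphi0.
  rewrite -[LHS]mul1r -dphi -cross_mulmx !mulmxA mulmxV // mul1mx Ek hphi.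
  by rewrite crossZl crossC chij oppr0 mulr0.
have [k Ek] := three_eigen_scalar _ _ _ _ (crx 0 1 isT) (crx 1 (1 + 1) isT)
  (crx 0 (1 + 1) isT) (Dj 0) (Dj 1) (Dj (1 + 1)).
have {}Ek : chi = k *: phi.
  by rewrite -mul_mx_scalar -Ek mulmxA mulmxV // mul1mx.
have k0 : k != 0.
  apply/eqP => E; have := rep_neq0 (y 0).
  by rewrite Ey Ek E scale0r mul0mx eqxx.
move=> t; have := chiC t; rewrite Ek /comm_mx -scalemxAr -scalemxAl.
by move=> /(scalerI k0).
Qed.

(** * The involution fixing two points *)

Lemma Cmx_trace a q : \tr (Cmx a q : 'M[R]_2) = 0.
Proof. by case: q => [b|]; rewrite tr2E !mxE /= subrr. Qed.

Lemma Cmx_det_lt0 (a : R) q : pltb (Some a) q -> \det (Cmx a q) < 0.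
Proof.
by case: q => [b|] /=; rewrite det2E !mxE /= => ab; nra.
Qed.

Lemma Cmx_form (a : R) q p : cross (rep p) (Cmx a q *m rep p) =
  match q, p with
  | Some b, Some r => (r - a) * (r - b)
  | Some _, None => 1
  | None, Some r => a - r
  | None, None => 0
  end.
Proof.
by case: p => [r|]; case: q => [b|]; rewrite /cross !mulmx2E ?repS ?repN !mxE /=; field.
Qed.

(** The form of [Cmx a q] is negative exactly on the open interval from [a] to
    [q], and it vanishes only at the two ends. *)
Lemma Cmx_form_lt0 (a : R) q p : pltb (Some a) q ->
  (cross (rep p) (Cmx a q *m rep p) < 0) = pltb (Some a) p && pltb p q.
Proof.
rewrite Cmx_form; case: q p => [b|] [r|] //=.
- move=> ab; apply/idP/idP => [H|/andP[H1 H2]]; last by nra.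
  by apply/andP; split; nra.
- by rewrite ltr10.
- by rewrite andbT subr_lt0.
Qed.

Lemma Cmx_form_eq0 (a : R) q p :
  cross (rep p) (Cmx a q *m rep p) = 0 -> p = Some a \/ p = q.
Proof.
rewrite Cmx_form; case: q p => [b|] [r|] //=.
- by move=> /eqP; rewrite mulf_eq0 !subr_eq0 => /orP[] /eqP ->; [left|right].
- by move=> /eqP; rewrite oner_eq0.
- by move=> E; left; congr Some; lra.
- by right.
Qed.

Lemma Cmx_fix_left (a : R) q : pltb (Some a) q ->
  mobius (Cmx a q) (Some a) = Some a.
Proof.
move=> aq; apply/mobius_fixP; first by rewrite lt_eqF // Cmx_det_lt0.
by rewrite Cmx_form; case: q aq => [b|] _; rewrite subrr ?mul0r.
Qed.

Lemma Cmx_fix_right (a : R) q : pltb (Some a) q -> mobius (Cmx a q) q = q.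
Proof.
move=> aq; apply/mobius_fixP; first by rewrite lt_eqF // Cmx_det_lt0.
by rewrite Cmx_form; case: q aq => [b|] _ //; rewrite subrr ?mulr0.
Qed.

Lemma CmxK (a : R) q p : pltb (Some a) q ->
  mobius (Cmx a q) (mobius (Cmx a q) p) = p.
Proof.
move=> /Cmx_det_lt0 d0; have dn : \det (Cmx a q) != 0 by rewrite lt_eqF.
by rewrite -mobiusM // traceless_sqr ?Cmx_trace // mobius_scalar // oppr_eq0.
Qed.

(** The involution sends the points outside the closed interval inside, since
    its determinant is negative. *)
Lemma Cmx_swap (a : R) q p : pltb (Some a) q ->
  0 < cross (rep p) (Cmx a q *m rep p) ->
  cross (rep (mobius (Cmx a q) p)) (Cmx a q *m rep (mobius (Cmx a q) p)) < 0.
Proof.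
move=> /Cmx_det_lt0 d0 Qp; have dn : \det (Cmx a q) != 0 by rewrite lt_eqF.
have [k k0 E] := mobius_rep _ p dn.
rewrite -(pmulr_rlt0 _ (_ : 0 < k ^+ 2)); last by rewrite lt_def sqrf_eq0 k0 sqr_ge0.
by rewrite expr2 -mulrA -crossZr -crossZl scalemxAr -E cross_mulmx nmulr_rlt0.
Qed.

Lemma fixed_pair_comm A (a : R) q : \det A != 0 -> pltb (Some a) q ->
  mobius A (Some a) = Some a -> mobius A q = q -> comm_mx A (Cmx a q).
Proof.
move=> dA aq Aa Aq; have dC : \det (Cmx a q) != 0 by rewrite lt_eqF // Cmx_det_lt0.
have [k1 _ E1] := mobius_rep _ (Some a) dA; rewrite Aa in E1.
have [k2 _ E2] := mobius_rep _ q dA; rewrite Aq in E2.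
have [k3 _ E3] := mobius_rep _ (Some a) dC; rewrite Cmx_fix_left // in E3.
have [k4 _ E4] := mobius_rep _ q dC; rewrite Cmx_fix_right // in E4.
apply: (eigenbasis_comm _ _ _ _ _ _ _ _ _ E1 E2 E3 E4).
rewrite cross_rep_eq0; case: (q) aq => [b|] //= ab.
by apply/eqP => -[E]; rewrite E ltxx in ab.
Qed.

End MoebiusFlows.

Arguments cross {R} u v.
Arguments rep {R} p.

(** * Intervals transported by one-parameter subgroups *)

Theorem proposition3p12 (R : realType) (x y : 'I_3 -> projline R)
    (phi : 'M[R]_2)
    (hxy : aligned x y)
    (hne : forall j : 'I_3, x j <> y j)
    (hdet : \det phi = 1)
    (hphi : forall j : 'I_3, mobius phi (x j) = y j) :
  ((forall p q : projline R, mobius phi p = p -> mobius phi q = q -> p = q) ->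
    exists psi : R -> 'M[R]_2,
      [/\ one_param_subgroup psi,
          maps_first_interval x y psi
        & forall psi' : R -> 'M[R]_2,
            one_param_subgroup psi' -> maps_first_interval x y psi' ->
            exists c : R, c != 0 /\ forall t : R, psi' t = psi (c * t)])
  /\
  (forall (a : R) (b : projline R),
    mobius phi (Some a) = Some a -> mobius phi b = b -> pltb (Some a) b ->
    let C := mobius (Cmx a b) in
    let inside (j : 'I_3) := pltb (Some a) (x j) && pltb (x j) b in
    let x' (j : 'I_3) := if inside j then x j else C (x j) in
    let y' (j : 'I_3) := if inside j then y j else C (y j) in
    let x'' (j : 'I_3) := if inside j then C (x j) else x j in
    let y'' (j : 'I_3) := if inside j then C (y j) else y j in
    exists psi : R -> 'M[R]_2,
      [/\ one_param_subgroup psi,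
          exists t : R, psi t != 1%:M
        & forall j : 'I_3, j != 0 ->
            exists t : R,
              [/\ mobius (psi t) (x' 0) = x' j,
                  mobius (psi t) (x'' 0) = x'' j,
                  mobius (psi t) (y' 0) = y' j
                & mobius (psi t) (y'' 0) = y'' j]]).
Proof.
have [xinj _ _] := hxy.
have dphi : \det phi != 0 by rewrite hdet oner_eq0.
have nfix j : mobius phi (x j) <> x j by rewrite hphi => /esym/hne.
split.
- move=> one_fix.
  have tr4 : \tr phi ^+ 2 <= 4.
    rewrite leNgt; apply/negP => /(hyperbolic_two_fixed _ _ hdet)[p [q [pq fp fq]]].
    exact/pq/one_fix.
  set m := \tr phi / 2; set N := phi - m%:M.
  have trN : \tr N = 0.
    by rewrite raddfB /= mxtrace_scalar /m mulr2n -splitr subrr.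
  have phiN : phi = m%:M + 1 *: N by rewrite scale1r addrC subrK.
  have dN : 0 <= \det N.
    have := hdet; rewrite phiN det_pencil // /m => E.
    by move: tr4 E; set T := \tr phi; nra.
  have Qx j : cross (rep (x j)) (N *m rep (x j)) != 0.
    apply/eqP => E; apply: (nfix j); apply/mobius_fixP => //.
    by rewrite phiN mulmxDl mul_scalar_mx scale1r crossDr crossZr crossv E mulr0 addr0.
  have [psi [H pen par trans]] := traceless_flow _ N trN.
  have [_ d1 _] := H.
  exists psi; split=> //.
    move=> j _; have [a [b [_ F]]] := pencil_transport _ N _ (x j) (Qx 0).
    have [|t Et] := trans (x 0) (x j).
      rewrite -F mulrCA -expr2 mulr_gt0 //.
        rewrite lt_def; apply/andP; split.
          by have := Qx j; rewrite -F mulf_eq0 negb_or => /andP[].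
        by rewrite det_pencil // addr_ge0 ?sqr_ge0 // mulr_ge0 ?sqr_ge0.
      by rewrite exprn_even_gt0 //= Qx.
    exists t; split=> //.
    have [a' [b' E]] := pen t.
    rewrite -(hphi 0) -(hphi j) -Et mobius_comm // ?d1 ?oner_eq0 //.
    rewrite E; apply: comm_mx_sym; apply: comm_pencilr.
    by rewrite phiN; apply: comm_mx_sym; apply: comm_pencilr.
  move=> psi' H' mf'; have [_ d1' _] := H'.
  (* A positive trace selects the half [0 < a] of the conic, which the flow
     reaches through elements of positive trace. *)
  have [e e0 tr'] := one_param_trace_gt0 _ psi' H'.
  have [a [b Ee]] : exists a b : R, psi' e = a%:M + b *: N.
    apply: (comm_pencil _ _ _ (rep (x 0))) => //.
    have := maps_first_interval_comm _ x y phi psi' xinj hdet hphi H' mf' e.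
    rewrite {1}phiN /comm_mx mulmxDl mulmxDr scalar_mxC !scale1r.
    by move=> /addrI.
  have a0 : 0 < a.
    have := tr' e; rewrite lexx ltW // => /(_ isT).
    by rewrite Ee raddfD /= linearZ /= trN mulr0 addr0 mxtrace_scalar pmulrn_lgt0.
  have [|s [Es pos]] := par a b (ltW a0); first by rewrite -Ee d1'.
  have E t : psi' t = psi (s / e * t).
    apply: (one_param_eq _ psi' (fun t => psi (s / e * t)) e) => //.
    - exact: one_param_scale.
    - move=> r /andP[r0 re]; rewrite (_ : s / e * r = r / e * s); last by ring.
      apply: pos => //; rewrite divr_ge0 ?(ltW e0) //=.
      by rewrite ler_pdivrMr // mul1r.
    - by rewrite divfK ?gt_eqF // Es.
  (* The parameter cannot vanish: [psi'] would be trivial, but it moves [x 0]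
     to [x 1]. *)
  exists (s / e); split=> //; apply/eqP => c0.
  have [t [Et _]] := mf' 1 isT; move: Et.
  by rewrite E c0 mul0r one_param0 // mobius_scalar ?oner_eq0 // => /xinj.
- move=> a b fa fb ab C inside x' y' x'' y''.
  have dC0 := Cmx_det_lt0 _ _ _ ab; have trC := Cmx_trace _ a b.
  have dC : \det (Cmx a b) != 0 by rewrite lt_eqF.
  have phiC := fixed_pair_comm _ _ _ _ dphi ab fa fb.
  have [psi [H pen par trans]] := traceless_flow _ _ trC.
  have [_ d1 _] := H; have d1n t : \det (psi t) != 0 by rewrite d1 oner_eq0.
  have CK p : C (C p) = p by exact: CmxK.
  have C_phi p : C (mobius phi p) = mobius phi (C p).
    by apply: mobius_comm => //; exact: comm_mx_sym.
  have Ey' j : y' j = mobius phi (x' j).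
    by rewrite /y' /x' -hphi; case: ifP => // _; exact: C_phi.
  have Ex'' j : x'' j = C (x' j) by rewrite /x'' /x'; case: ifP => // _; rewrite CK.
  have Ey'' j : y'' j = mobius phi (C (x' j)).
    by rewrite /y'' /x' -hphi; case: ifP => _; rewrite ?CK ?C_phi.
  have Qx' j : cross (rep (x' j)) (Cmx a b *m rep (x' j)) < 0.
    rewrite /x' /inside; case: ifP => [|/negbT]; rewrite -Cmx_form_lt0 // -leNgt => Q0.
    apply: Cmx_swap => //; rewrite lt_def Q0 andbT.
    by apply/eqP => /Cmx_form_eq0[] Ex; apply: (nfix j); rewrite Ex.
  exists psi; split=> //.
    (* The element [sqrt (1 - det C) + C] of the flow has trace above 2. *)
    have r0 : 0 <= 1 - \det (Cmx a b) by lra.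
    have [|t [Et _]] := par (Num.sqrt (1 - \det (Cmx a b))) 1 (sqrtr_ge0 _).
      by rewrite det_pencil // sqr_sqrtr //; ring.
    exists t; apply/eqP => /(congr1 mxtrace).
    rewrite Et raddfD /= linearZ /= trC mulr0 addr0 !mxtrace_scalar.
    move=> E1; have {}E1 : Num.sqrt (1 - \det (Cmx a b)) = 1 by lra.
    have := sqr_sqrtr r0; rewrite E1; lra.
  move=> j _; have [|t Et] := trans (x' 0) (x' j).
    by rewrite nmulr_lgt0.
  have psi_C : comm_mx (psi t) (Cmx a b).
    by have [a' [b' ->]] := pen t; apply: comm_mx_sym; apply: comm_pencilr.
  have psi_phi : comm_mx (psi t) phi.
    by have [a' [b' ->]] := pen t; apply: comm_mx_sym; apply: comm_pencilr.
  have tC : mobius (psi t) (C (x' 0)) = C (x' j).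
    by rewrite /C mobius_comm // Et.
  by exists t; rewrite !Ex'' !Ey' !Ey''; split=> //; rewrite mobius_comm // ?Et ?tC.
Qed.
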